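(* There is a universal constant $C>0$ such that for every set $\mathcal{E}\subset\mathbb{Z}^3\setminus\{0\}$ of diameter $R\ge1$ one has $$\sum_{m\in\mathcal{E}}\frac{1}{|m_*|}\le C\,R^2 .$$
   Context: For $m\in\mathbb{Z}^d$, $m\neq0$, $m_*$ denotes $m$ divided by the greatest common divisor of its coordinates (and $m_*:=0$ if $m=0$). $|\cdot|$ is the Euclidean norm, and diameter is with respect to Euclidean distance. *)

(* Defs.v *)
From HB Require Import structures.
From mathcomp Require Import all_boot all_order all_algebra.
From mathcomp Require Import all_classical all_reals all_analysis.
Set Implicit Arguments.
Unset Strict Implicit.
Unset Printing Implicit Defensive.
Import Order.TTheory GRing.Theory Num.Theory.
Local Open Scope ring_scope.
Local Open Scope classical_set_scope.

Definition coord_gcd (d : nat) (m : 'rV[int]_d) : nat :=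
  \big[gcdn/0%N]_(i < d) absz (m 0 i).

(* m_*; when m = 0 the divisor is 0 and divz 0 0 = 0, so 0_* = 0. *)
Definition primitive_part (d : nat) (m : 'rV[int]_d) : 'rV[int]_d :=
  \row_(i < d) divz (m 0 i) (coord_gcd m)%:Z.

(* The library's norm on matrices is the sup norm, hence this one. *)
Definition euclidean_norm (R : realType) (d : nat) (m : 'rV[int]_d) : R :=
  Num.sqrt (\sum_(i < d) (m 0 i)%:~R ^+ 2).

(* Extended-real valued: +oo for an unbounded set, -oo for the empty set. *)
Definition diameter (R : realType) (d : nat) (E : set 'rV[int]_d) : \bar R :=
  ereal_sup [set (euclidean_norm R (x - y))%:E | x in E & y in E].

(* Main.v *)
Require Import Defs.
From HB Require Import structures.
From mathcomp Require Import all_boot all_order all_algebra.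
From mathcomp Require Import all_classical all_reals all_analysis.
From mathcomp Require Import zify ring lra.

(** Write h(m) for the sup norm of the primitive vector m_*.  As h(m) <= |m_*|,
    it is enough to bound the sum of 1/h(m).  A set of diameter r >= 1 lies in
    a cubical box of side n = 2N+1 <= 3r, N being the integer part of r, but
    this box may be arbitrarily far from the origin.

    The points with h(m) >= n are harmless: there are at most n^3 of them, each
    contributing at most 1/n.

    For 0 < j < n the key point is that only O(nj) points m of the box have
    h(m) = j ([card_height], [card_height3_le]).  Some coordinate of m_* equals
    j or -j, so the same coordinate of m is a multiple of j in an interval of n
    consecutive integers; there are O(n/j) of those.  The other two coordinates
    of m_* lie in [-j, j], which leaves O(j^2) possibilities.  These data
    determine m: the selected coordinate of m is nonzero, so its sign is the
    sign of that coordinate of m_*, and its quotient by j is the gcd of m.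

    Each level j < n therefore contributes O(nj)/j = O(n), and the n levels
    together contribute O(n^2).  Dimension three enters through this
    cancellation of the powers of j. *)

Import Order.TTheory GRing.Theory Num.Theory.
Local Open Scope ring_scope.
Local Open Scope classical_set_scope.

(** * The sup norm of the primitive part *)

Definition primitive_height {d : nat} (m : 'rV[int]_d) : nat :=
  \max_(i < d) absz (primitive_part m 0%R i).

Lemma primitive_partK {d : nat} (m : 'rV[int]_d) (i : 'I_d) :
  m 0 i = primitive_part m 0 i * (coord_gcd m)%:Z.
Proof.
rewrite [in RHS]mxE divzK // dvdzE absz_nat.
by apply: biggcdn_inf (dvdnn _).
Qed.

Lemma abs_primitive_part_le {d : nat} (m : 'rV[int]_d) (i : 'I_d) :
  (absz (primitive_part m 0%R i) <= primitive_height m)%N.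
Proof. exact: (leq_bigmax i). Qed.

Lemma primitive_height_gt0 {d : nat} (m : 'rV[int]_d) :
  m != 0 -> (0 < primitive_height m)%N.
Proof.
apply: contraNT; rewrite -leqNgt leqn0 => /eqP h0.
apply/eqP/rowP => i; rewrite primitive_partK [RHS]mxE.
by have := abs_primitive_part_le m i; rewrite h0 leqn0 absz_eq0 => /eqP ->; rewrite mul0r.
Qed.

Lemma abs_coord_le_norm (R : realType) {d : nat} (m : 'rV[int]_d) (i : 'I_d) :
  (absz (m 0%R i))%:R <= euclidean_norm R m.
Proof.
rewrite /euclidean_norm -[X in X <= _]ger0_norm ?ler0n// -sqrtr_sqr.
rewrite ler_sqrt ?sumr_ge0// => [|j _]; last exact: sqr_ge0.
rewrite (bigD1 i)//= natr_absz -rmorphXn/= real_normK ?num_real// rmorphXn/=.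
by rewrite lerDl sumr_ge0// => j _; exact: sqr_ge0.
Qed.

Lemma primitive_height_attained {d : nat} (m : 'rV[int]_d.+1) :
  exists i, absz (primitive_part m 0 i) = primitive_height m.
Proof.
have [|i hi] := @bigop.eq_bigmax _
    (fun i : 'I_d.+1 => absz (primitive_part m 0%R i)).
  by rewrite card_ord.
by exists i; rewrite /primitive_height hi.
Qed.

Lemma primitive_height_le_norm (R : realType) {d : nat} (m : 'rV[int]_d.+1) :
  (primitive_height m)%:R <= euclidean_norm R (primitive_part m).
Proof.
by have [i <-] := primitive_height_attained m; exact: abs_coord_le_norm.
Qed.

(** One nonzero coordinate of [m], compared with that of [m_*], gives the gcd by
    which [m_*] must be multiplied; its sign is recovered as well, so only the
    absolute value of that coordinate of [m_*] has to be recorded. *)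
Lemma primitive_decomposition_inj {d : nat} (m m' : 'rV[int]_d) (i : 'I_d) :
  m 0 i = m' 0 i -> m 0 i != 0 ->
  absz (primitive_part m 0 i) = absz (primitive_part m' 0 i) ->
  (forall k, k != i -> primitive_part m 0 k = primitive_part m' 0 k) -> m = m'.
Proof.
move=> mi mi0 pi pk.
have p0 : primitive_part m 0 i != 0.
  by apply: contraNneq mi0 => p0; rewrite primitive_partK p0 mul0r.
have g : coord_gcd m = coord_gcd m'.
  have := congr1 absz mi; rewrite (primitive_partK m) (primitive_partK m').
  rewrite !abszM -pi !absz_nat => /eqP.
  by rewrite eqn_pmul2l ?absz_gt0// => /eqP.
apply/rowP => k; have [->//|ki] := eqVneq k i.
by rewrite primitive_partK pk// g -primitive_partK.
Qed.

Lemma primitive_part_neq0 {d : nat} (m : 'rV[int]_d) (i : 'I_d) :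
  primitive_part m 0 i != 0 -> m 0 i != 0.
Proof. by apply: contraNneq => mi0; rewrite mxE mi0 div0z. Qed.

(** * Points of given height in a box *)

Definition box_point {n d : nat} (a : 'rV[int]_d) (t : 'rV['I_n]_d) :
  'rV[int]_d := \row_i (a 0 i + (t 0 i)%:Z).

Lemma box_point_inj {n d : nat} (a : 'rV[int]_d) :
  injective (@box_point n d a).
Proof.
move=> s t /rowP st; apply/rowP => i; apply: val_inj; apply/eqP.
by have := st i; rewrite !mxE => /addrI [] /eqP.
Qed.

(** Two multiples of [j] in the interval whose offsets have the same quotient
    by [j] also have offsets congruent modulo [j], hence coincide. *)
Lemma card_multiples {n j : nat} (b : int) :
  (0 < j)%N ->
  (#|[pred u : 'I_n | (j %| (b + (u : nat)%:Z)%R)%Z]| <= (n %/ j).+1)%N.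
Proof.
move=> j0; rewrite -[X in (_ <= X)%N]card_ord.
have lt (u : 'I_n) : (u %/ j < (n %/ j).+1)%N by rewrite ltnS leq_div2r // ltnW.
apply: (@leq_card_in _ _ (fun u : 'I_n => Ordinal (lt u))) => u v.
rewrite !inE => du dv [/eqP euv]; apply/val_inj.
have /= : (u%:Z = v%:Z %[mod j])%Z.
  apply/eqP; rewrite eqz_mod_dvd.
  by have := rpredB du dv; rewrite opprD addrACA subrr add0r.
rewrite !modz_nat => -[muv].
by rewrite /= (divn_eq u j) (divn_eq v j) (eqP euv) muv.
Qed.

(** Faithful only on [-j, j], where the coordinates of [m_*] lie when [m] has
    height [j]. *)
Definition shift_code (j : nat) (x : int) : 'I_(2 * j).+1 := inord (absz (x + j%:Z)).

Lemma shift_code_inj (j : nat) (x y : int) :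
  (absz x <= j)%N -> (absz y <= j)%N -> shift_code j x = shift_code j y -> x = y.
Proof.
move=> xj yj /(congr1 val); rewrite /= !inordK; lia.
Qed.

(** The point is encoded by its coordinate [i], a multiple of [j], together with
    the coordinates of its primitive part other than [i]. *)
Lemma card_height_coord {n d : nat} (a : 'rV[int]_d.+1) (j : nat) (i : 'I_d.+1) :
  (0 < j)%N ->
  (#|[set t : 'rV['I_n]_d.+1 | (primitive_height (box_point a t) == j) &&
      (absz (primitive_part (box_point a t) 0%R i) == j)]%SET|
     <= (n %/ j).+1 * (2 * j).+1 ^ d)%N.
Proof.
move=> j0; set A := (X in (#|pred_of_set X| <= _)%N).
pose p (t : 'rV['I_n]_d.+1) := primitive_part (box_point a t).
pose code (t : 'rV['I_n]_d.+1) : 'I_n * 'rV['I_(2 * j).+1]_d :=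
  (t 0 i, \row_k shift_code j (p t 0 (lift i k))).
have inj : {in A &, injective code}.
  move=> s t; rewrite !inE => /andP[/eqP hs /eqP ps] /andP[/eqP ht /eqP pt].
  case=> sti /rowP stk; apply: (@box_point_inj _ _ a).
  apply: (@primitive_decomposition_inj _ _ _ i).
  - by rewrite !mxE sti.
  - by apply: primitive_part_neq0; rewrite -absz_gt0 ps.
  - by rewrite ps pt.
  - move=> k; case: (unliftP i k) => [l -> _|->]; last by rewrite eqxx.
    have := stk l; rewrite [LHS]mxE [RHS]mxE => /shift_code_inj; apply.
      by rewrite -hs; exact: abs_primitive_part_le.
    by rewrite -ht; exact: abs_primitive_part_le.
rewrite -(card_in_imset inj).
pose M := [set u : 'I_n | (j %| (a 0 i + (u : nat)%:Z)%R)%Z]%SET.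
have cM : (#|M| <= (n %/ j).+1)%N.
  by have := card_multiples (n := n) (a 0 i) j0; rewrite cardsE.
have cV : #|[set: 'rV['I_(2 * j).+1]_d]%SET| = ((2 * j).+1 ^ d)%N.
  by rewrite cardsT card_mx card_ord mul1n.
rewrite -cV (leq_trans _ (leq_mul cM (leqnn _)))// -cardsX subset_leq_card//.
apply/fintype.subsetP => _ /imsetP[t + ->]; rewrite !inE/= => /andP[_ /eqP pt].
rewrite andbT; have := primitive_partK (box_point a t) i; rewrite mxE => ->.
by rewrite dvdzE absz_nat abszM pt dvdn_mulr.
Qed.

(** Some coordinate of the primitive part attains the height, so this is a
    union bound over its index. *)
Lemma card_height {n d : nat} (a : 'rV[int]_d.+1) (j : nat) :
  (0 < j)%N ->
  (#|[set t : 'rV['I_n]_d.+1 | primitive_height (box_point a t) == j]%SET|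
     <= d.+1 * ((n %/ j).+1 * (2 * j).+1 ^ d))%N.
Proof.
move=> j0.
pose A i := [set t : 'rV['I_n]_d.+1 | (primitive_height (box_point a t) == j) &&
      (absz (primitive_part (box_point a t) 0%R i) == j)]%SET.
apply: (@leq_trans (\sum_(i < d.+1) #|A i|)); last first.
  rewrite -[X in (_ <= X * _)%N]card_ord -sum_nat_const leq_sum// => i _.
  exact: card_height_coord.
rewrite cardsE -sum1_card big_mkcond/=.
under [X in (_ <= X)%N]eq_bigr do rewrite -sum1_card big_mkcond/=.
rewrite exchange_big/= leq_sum// => t _; rewrite unfold_in/=.
case: eqnP => // ht.
have [i hi] := primitive_height_attained (box_point a t).
by rewrite (bigD1 i)//= inE hi ht eqxx.
Qed.

(** In dimension three the [O(j ^ 2)] choices for the remaining coordinates and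
    the [O(n / j)] multiples combine into a bound linear in [j]. *)
Lemma card_height3_le {n : nat} (a : 'rV[int]_3) (j : nat) :
  (j <= n)%N ->
  (0 < j)%N ->
  (#|[set t : 'rV['I_n]_3 | primitive_height (box_point a t) == j]%SET|
     <= 54 * n * j)%N.
Proof.
move=> jn j0; apply: (leq_trans (@card_height n 2 a j j0)).
(* j <= n absorbs the rounding in the number of multiples. *)
have h1 : ((n %/ j).+1 * j <= 2 * n)%N.
  by rewrite mulSn mul2n -addnn leq_add// leq_trunc_div.
have h2 : ((2 * j).+1 ^ 2 <= 9 * (j * j))%N.
  by rewrite -[X in (_ <= X * _)%N]/(3 * 3)%N mulnACA leq_mul//; lia.
apply: (@leq_trans (3 * ((n %/ j).+1 * (9 * (j * j))))).
  by rewrite leq_mul2l leq_mul2l h2.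
by have := leq_mul h1 (leqnn (27 * j)); lia.
Qed.

(** * Summation over the levels *)

(** Levels [j < n] contribute at most [54 * n] each, the points of height at
    least [n] at most [n ^ 3 / n] in total.  The origin, if it lies in the box,
    has height 0 and hence contributes [0^-1 = 0]. *)
Lemma sum_inv_height_le {R : realType} {n : nat} (a : 'rV[int]_3) :
  (0 < n)%N ->
  \sum_(t : 'rV['I_n]_3) (primitive_height (box_point a t))%:R^-1
    <= 55 * n%:R ^+ 2 :> R.
Proof.
move=> n0; pose h (t : 'rV['I_n]_3) := primitive_height (box_point a t).
(* The first term pays for heights >= n, the sum for heights < n. *)
have pointwise t : (h t)%:R^-1
    <= n%:R^-1 + \sum_(j < n) (h t == j)%:R * (j : nat)%:R^-1 :> R.
  have [hn|nh] := ltnP (h t) n.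
    rewrite (bigD1 (Ordinal hn))//= eqxx mul1r addrCA lerDl addr_ge0//.
    by rewrite sumr_ge0// => j _; rewrite mulr_ge0.
  apply: ler_wpDr; first by rewrite sumr_ge0// => j _; rewrite mulr_ge0.
  by rewrite lef_pV2 ?posrE ?ltr0n ?ler_nat//; lia.
apply: (le_trans (ler_sum _ (fun t _ => pointwise t))).
rewrite big_split/= sumr_const card_mx card_ord exchange_big/=.
have level (j : 'I_n) :
    \sum_(t : 'rV['I_n]_3) (h t == j)%:R * (j : nat)%:R^-1 <= 54 * n%:R :> R.
  rewrite -mulr_suml -natr_sum.
  have [->|j0] := posnP j; first by rewrite invr0 mulr0.
  rewrite ler_pdivrMr ?ltr0n// -!natrM ler_nat.
  apply: (leq_trans _ (@card_height3_le n a j (ltnW (ltn_ord j)) j0)).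
  by rewrite cardsE -sum1_card [leqRHS]big_mkcond/= leq_sum.
have -> : 55 * n%:R ^+ 2 = n%:R^-1 *+ n ^ (1 * 3) + 54 * n%:R *+ n :> R.
  rewrite -[n%:R^-1 *+ _]mulr_natr -[_ *+ n]mulr_natr natrX.
  by field; rewrite pnatr_eq0 -lt0n.
by rewrite lerD2l -[X in _ *+ X]card_ord -sumr_const ler_sum.
Qed.

Lemma esum_le_sum {R : realType} {T : finType} (P : set T) (f : T -> R) :
  (forall t, 0 <= f t) ->
  (\esum_(t in P) (f t)%:E <= (\sum_t f t)%:E)%E.
Proof.
move=> f0; apply: ge_ereal_sup => _ [X [finX _] <-].
rewrite fsbig_finite//= sumEFin lee_fin big_uniq ?finmap.fset_uniq//=.
by rewrite [leRHS](bigID (fun t => t \in finmap.enum_fset (fset_set X)))/= lerDl sumr_ge0.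
Qed.

(** Coordinates of two points of [E] differ by integers of absolute value at most
    [r], so a cube centred at any one point of [E] contains [E]. *)
Lemma mem_box_of_diameter {R : realType} {d : nat} {E : set 'rV[int]_d} {r : R}
    {x y : 'rV[int]_d} :
  diameter R E = r%:E -> E x -> E y ->
  exists t : 'rV['I_(2 * Num.truncn r).+1]_d,
    box_point (\row_i (x 0 i - (Num.truncn r)%:Z)) t = y.
Proof.
move=> diam Ex Ey; set N := Num.truncn r.
have near (i : 'I_d) : (absz (y 0%R i - x 0%R i)%R <= N)%N.
  have dyx : euclidean_norm R (y - x) <= r.
    by rewrite -lee_fin -diam; apply: ereal_sup_ubound; exists y => //; exists x.
  have r0 : 0 <= r := le_trans (sqrtr_ge0 _) dyx.
  rewrite truncn_ge_nat// (le_trans _ dyx)//.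
  by have := abs_coord_le_norm R (y - x) i; rewrite !mxE.
exists (\row_i inord (absz (y 0 i - x 0 i + N%:Z)%R)).
apply/rowP => i; rewrite !mxE inordK; have := near i; lia.
Qed.

Theorem lemma3p7 (R : realType) :
  exists2 C : R, 0 < C &
    forall (E : set 'rV[int]_3) (r : R),
      E `<=` ~` [set 0] ->
      diameter R E = r%:E ->
      1 <= r ->
      (\esum_(m in E) ((euclidean_norm R (primitive_part m))^-1)%:E
         <= (C * r ^+ 2)%:E)%E.
Proof.
(* 495 = 55 * 3 ^ 2, since the box has side n = 2N+1 <= 3r. *)
exists 495 => // E r E0 diam r1.
have [->|/set0P[x Ex]] := eqVneq E set0.
  by rewrite esum_set0 lee_fin mulr_ge0 ?sqr_ge0.
pose N := Num.truncn r.
pose F := @box_point (2 * N).+1 _ (\row_i (x 0 i - N%:Z)).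
have bij : set_bij [set t | E (F t)] E F.
  split => // [s t _ _|y Ey]; first exact: box_point_inj.
  have [t ty] := mem_box_of_diameter diam Ex Ey.
  by exists t => //=; rewrite /F ty.
rewrite (reindex_esum _ _ _ _ bij).
pose f t := (primitive_height (F t))%:R^-1 : R.
apply: (@le_trans _ _ (\esum_(t in [set t | E (F t)]) (f t)%:E)%E).
  apply: le_esum => t Et; rewrite lee_fin.
  have h0 : 0 < (primitive_height (F t))%:R :> R.
    by rewrite ltr0n primitive_height_gt0//; apply/eqP => Ft0; apply: (E0 _ Et).
  have hle := primitive_height_le_norm R (F t).
  by rewrite lef_pV2// posrE (lt_le_trans h0).
apply: (le_trans (esum_le_sum _ _ _)) => [t|]; first by rewrite invr_ge0.
rewrite lee_fin (le_trans (sum_inv_height_le _ _))//.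
have /truncn_itv/andP[Nr _] : 0 <= r := le_trans ler01 r1.
have n3r : ((2 * N).+1)%:R <= 3 * r by rewrite -natr1 natrM; lra.
rewrite (_ : 495 * r ^+ 2 = 55 * (3 * r) ^+ 2); last by ring.
by rewrite ler_pM2l// lerXn2r ?nnegrE//; lra.
Qed.
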